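(* Let $S$ be a group and let $\cdot\colon A\times S\to A$ be a partial action of the group $S$ on a set $A$, i.e. a partial map satisfying: (PA) if $a\cdot s$ and $(a\cdot s)\cdot t$ are defined then $a\cdot st$ is defined and $(a\cdot s)\cdot t=a\cdot st$; (Um) for all $a\in A$, $a\cdot 1$ is defined and $a\cdot 1=a$; (I) if $a\cdot g$ is defined then $(a\cdot g)\cdot g^{-1}$ is defined and $(a\cdot g)\cdot g^{-1}=a$. Let $(B,* )$ and $(C,\circ)$ be $A$-generated globalizations of $(A,\cdot)$ via injective maps $\iota\colon A\to B$ and $i\colon A\to C$, respectively. Then the map $B\to C$, $\iota(a)*s\mapsto i(a)\circ s$, is (well defined and) an isomorphism of global $S$-acts. In particular, $A\otimes S$ and $A^S$ are isomorphic via the map $A\otimes S\to A^S$ given by $a\otimes s\mapsto f_{a,s}$.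
   Context: A partial map $f\colon X\to Y$ is a map $Z\to Y$ with $Z\subseteq X$, $Z=\mathrm{dom}(f)$; $f(x)$ is defined iff $x\in Z$; two partial maps are equal iff they have the same domain and the same values. All actions are right actions. A global action of $S$ on a set $B$ is a map $*\colon B\times S\to B$ with $(b*s)*t=b*(st)$; then $(B,* )$ is a global $S$-act. A morphism of global $S$-acts $(B,* )\to(C,\circ)$ is a map $\varphi$ with $\varphi(b*s)=\varphi(b)\circ s$. A globalization of $(A,\cdot)$ is a global $S$-act $(B,* )$ together with an injective map $\iota\colon A\to B$ such that for all $a\in A,s\in S$: (G1) $a\cdot s$ is defined iff $\iota(a)*s\in\iota(A)$; (G2) if $a\cdot s$ is defined then $\iota(a\cdot s)=\iota(a)*s$. It is $A$-generated if every $b\in B$ equals $\iota(a)*s$ for some $a\in A$, $s\in S$. Tensor product: for $(a,s),(b,t)\in A\times S$ write $(a,s)\to(b,t)$ if there is $u\in S$ such that $s=ut$ and $a\cdot u$ is defined and equals $b$. Let $\rho$ be the smallest equivalence relation on $A\times S$ containing $\to$; $A\otimes S=(A\times S)/\rho$, and $a\otimes s$ is the $\rho$-class of $(a,s)$. $S$ acts globally on $A\otimes S$ by $(a\otimes s)*t=a\otimes st$. For $a\in A$, $s\in S$ let $f_{a,s}\colon S\to A$ be the partial map with $\mathrm{dom}(f_{a,s})=\{t\in S: a\cdot st\text{ is defined}\}$ and $f_{a,s}(t)=a\cdot st$. Put $A^S=\{f_{a,s}: a\in A,s\in S\}$, with the (well-defined) global action $f_{a,s}*t=f_{a,st}$.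 *)

(* Defs.v *)
From Stdlib Require Import Relation_Definitions.
From HB Require Import structures.
From mathcomp Require Import all_boot.
From mathcomp Require Import boolp classical_sets.

Set Implicit Arguments.
Unset Strict Implicit.
Unset Printing Implicit Defensive.

Local Open Scope group_scope.
Local Open Scope quotient_scope.

(* A partial map X -> Y is a function f : X -> option Y, with domain
   {x | f x is Some}; two such functions are equal iff they have the same domain
   and the same values.  [semigroupType] and [groupType] are not assumed
   finite. *)

(* As S is only a semigroup here, no unit law is required. *)
Record globalAct (S : semigroupType) := GlobalAct {
  act_sort :> Type;
  act : act_sort -> S -> act_sort;
  actM : forall b s t, act (act b s) t = act b (s * t)
}.

Definition is_act_morphism (S : semigroupType) (B C : globalAct S)
    (phi : B -> C) : Prop :=
  forall b s, phi (act b s) = act (phi b) s.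

Definition is_act_iso (S : semigroupType) (B C : globalAct S)
    (phi : B -> C) : Prop :=
  is_act_morphism phi /\ bijective phi.

Record is_partial_group_action (S : groupType) (A : Type)
    (dot : A -> S -> option A) : Prop := {
  pact_PA : forall a b c s t,
    dot a s = Some b -> dot b t = Some c -> dot a (s * t) = Some c;
  pact_Um : forall a, dot a 1 = Some a;
  pact_I : forall a b g, dot a g = Some b -> dot b g^-1 = Some a
}.

Record is_globalization (S : semigroupType) (A : Type)
    (dot : A -> S -> option A) (B : globalAct S) (iota : A -> B) : Prop := {
  glob_inj : injective iota;
  glob_G1 : forall a s, isSome (dot a s) <-> range iota (act (iota a) s);
  glob_G2 : forall a b s, dot a s = Some b -> iota b = act (iota a) s
}.

Definition is_generated (S : semigroupType) (A : Type) (B : globalAct S)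
    (iota : A -> B) : Prop :=
  forall b : B, exists a s, b = act (iota a) s.

Section TensorProduct.
Variables (S : semigroupType) (A : Type) (dot : A -> S -> option A).

Definition tensor_step (p q : A * S) : Prop :=
  exists u : S, p.2 = u * q.2 /\ dot p.1 u = Some q.1.

Definition tensor_rho (p q : A * S) : Prop :=
  forall R : relation (A * S),
    equivalence _ R -> inclusion _ tensor_step R -> R p q.

Lemma tensor_rho_equivalence : equivalence _ tensor_rho.
Proof.
split.
- by move=> p R [Rr _ _] _; apply: Rr.
- move=> p q r pq qr R Re sR; have [_ Rt _] := Re.
  by apply: Rt (pq R Re sR) (qr R Re sR).
- by move=> p q pq R Re sR; have [_ _ Rs] := Re; apply: Rs (pq R Re sR).
Qed.

(* [{classic T}] is T with its classical choiceType structure, which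
   [{eq_quot _}] requires. *)
Definition tensor_rhob : rel {classic A * S} :=
  fun p q => `[< tensor_rho p q >].

Lemma tensor_rhob_equiv : equiv_class_of tensor_rhob.
Proof.
have [Rr Rt Rs] := tensor_rho_equivalence.
split.
- by move=> p; apply/asboolP; exact: Rr.
- by move=> p q; apply: asbool_equiv_eq; split; apply: Rs.
- by move=> q p r /asboolP pq /asboolP qr; apply/asboolP; apply: Rt pq qr.
Qed.

Canonical tensor_equiv_rel := EquivRelPack tensor_rhob_equiv.

Definition tensor_type : Type := {eq_quot tensor_equiv_rel}.

Definition tensor_pure (a : A) (s : S) : tensor_type :=
  \pi_({eq_quot tensor_equiv_rel}) ((a, s) : {classic A * S}).

Lemma tensor_pureP a s b t :
  tensor_pure a s = tensor_pure b t <-> tensor_rho (a, s) (b, t).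
Proof. by split => [/eqquotP/asboolP//|h]; apply/eqquotP/asboolP. Qed.

Definition tensor_act_op (x : tensor_type) (t : S) : tensor_type :=
  let p : A * S := repr (x : {eq_quot tensor_equiv_rel}) in
  tensor_pure p.1 (p.2 * t).

Lemma tensor_act_opE a s t :
  tensor_act_op (tensor_pure a s) t = tensor_pure a (s * t).
Proof.
rewrite /tensor_act_op; set p : A * S := repr _.
have : tensor_rho p (a, s).
  case E : p => [b v]; apply/tensor_pureP.
  by rewrite -[RHS]reprK /tensor_pure -E.
move=> /(_ (fun p q => tensor_rho (p.1, p.2 * t) (q.1, q.2 * t))) h.
apply/tensor_pureP; apply: h.
- have [Rr Rt Rs] := tensor_rho_equivalence.
  by split=> [x|x y z|x y] /=; [exact: Rr|exact: Rt|exact: Rs].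
- move=> x y [u [e d]] R Re; apply.
  by exists u; rewrite /= e mulgA.
Qed.

Lemma tensor_actM x s t :
  tensor_act_op (tensor_act_op x s) t = tensor_act_op x (s * t).
Proof.
by rewrite [tensor_act_op x s]/tensor_act_op tensor_act_opE -mulgA.
Qed.

Definition tensor : globalAct S := GlobalAct tensor_actM.

End TensorProduct.

Section FunctionAct.
Variables (S : semigroupType) (A : Type) (dot : A -> S -> option A).

Definition pfun (a : A) (s : S) : S -> option A := fun t => dot a (s * t).

Definition pfun_type : Type := {f : S -> option A | exists a s, f = pfun a s}.

Definition pfun_elt (a : A) (s : S) : pfun_type :=
  exist _ (pfun a s) (ex_intro _ a (ex_intro _ s erefl)).

Lemma pfun_shift (f : S -> option A) (t : S) :
  (exists a s, f = pfun a s) -> exists a s, (fun u => f (t * u)) = pfun a s.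
Proof.
by move=> [a [s ->]]; exists a, (s * t); apply: funext => u; rewrite /pfun mulgA.
Qed.

(* As f_{a,st}(u) = f_{a,s}(tu), the action f_{a,s} * t = f_{a,st} is
   precomposition with left translation by t; see [pfun_act_opE]. *)
Definition pfun_act_op (f : pfun_type) (t : S) : pfun_type :=
  exist _ (fun u => sval f (t * u)) (pfun_shift t (svalP f)).

Lemma pfun_act_opE a s t : pfun_act_op (pfun_elt a s) t = pfun_elt a (s * t).
Proof. by apply: eq_exist; apply: funext => u; rewrite /= /pfun mulgA. Qed.

Lemma pfun_actM f s t :
  pfun_act_op (pfun_act_op f s) t = pfun_act_op f (s * t).
Proof. by apply: eq_exist; apply: funext => u; rewrite /= mulgA. Qed.

Definition pfun_act : globalAct S := GlobalAct pfun_actM.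

End FunctionAct.

(* Main.v *)
(* In each of the acts involved, the elements [a . s] and [b . t] coming from
   (a, s) and (b, t) coincide iff [dot a (s * t^-1) = Some b]: translate by
   [t^-1] and use that S is a group.  This condition mentions only the partial
   action, so any two such acts are quotients of A x S by the same equivalence
   relation, hence isomorphic in exactly one way over A x S. *)
Require Import Defs.
From mathcomp Require Import all_boot.
From mathcomp Require Import boolp classical_sets.

Set Implicit Arguments.
Unset Strict Implicit.
Unset Printing Implicit Defensive.

Local Open Scope group_scope.

(** The value at [b] is [q x] for any preimage [x] of [b]; independence of [x] makes the relation
    functional, and classical choice turns it into a map. *)
Lemma factor_through (X B C : Type) (p : X -> B) (q : X -> C) :
  (forall b, exists x, b = p x) ->
  (forall x y, p x = p y -> q x = q y) ->
  exists phi : B -> C, forall x, phi (p x) = q x.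
Proof.
move=> p_surj pq.
have : forall b, exists c, forall x, b = p x -> c = q x.
  by move=> b; have [x ->] := p_surj b; exists (q x) => y /pq.
by move=> /choice[phi phiP]; exists phi => x; apply: phiP.
Qed.

(** Equal kernels let [p] and [q] factor through each other, giving mutually inverse maps;
    surjectivity of [p] forces uniqueness and reduces equivariance to the elements [p a s]. *)
Lemma unique_act_iso (S : semigroupType) (A : Type) (B C : globalAct S)
    (p : A -> S -> B) (q : A -> S -> C) :
  (forall b, exists a s, b = p a s) -> (forall c, exists a s, c = q a s) ->
  (forall a s t, act (p a s) t = p a (s * t)) ->
  (forall a s t, act (q a s) t = q a (s * t)) ->
  (forall a s b t, p a s = p b t <-> q a s = q b t) ->
  exists phi : B -> C,
    unique (fun psi : B -> C => forall a s, psi (p a s) = q a s) phi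
    /\ is_act_iso phi.
Proof.
move=> p_surj q_surj pM qM pq.
have [||phi phiE] := @factor_through (A * S) B C (uncurry p) (uncurry q).
- by move=> b; have [a [s ->]] := p_surj b; exists (a, s).
- by move=> [a s] [b t] /= /pq.
have [||psi psiE] := @factor_through (A * S) C B (uncurry q) (uncurry p).
- by move=> c; have [a [s ->]] := q_surj c; exists (a, s).
- by move=> [a s] [b t] /= /pq.
exists phi; split; first split.
- by move=> a s; apply: (phiE (a, s)).
- move=> chi chiE; apply: funext => b; have [a [s ->]] := p_surj b.
  by rewrite chiE; apply: (phiE (a, s)).
split.
- move=> b t; have [a [s ->]] := p_surj b.
  by rewrite pM (phiE (a, s * t)) (phiE (a, s)) /= qM.
- exists psi => [b|c].
  + by have [a [s ->]] := p_surj b; rewrite (phiE (a, s)) (psiE (a, s)).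
  + by have [a [s ->]] := q_surj c; rewrite (psiE (a, s)) (phiE (a, s)).
Qed.

Section PartialGroupAction.
Variables (S : groupType) (A : Type) (dot : A -> S -> option A).
Hypothesis hdot : is_partial_group_action dot.

Lemma pact_divg_sym a s b t :
  dot a (s * t^-1) = Some b -> dot b (t * s^-1) = Some a.
Proof. by move=> /(pact_I hdot); rewrite invgM invgK. Qed.

Lemma glob_act_eq (B : globalAct S) (iota : A -> B) :
  is_globalization dot iota ->
  forall a s b t,
    act (iota a) s = act (iota b) t <-> dot a (s * t^-1) = Some b.
Proof.
move=> hB a s b t; split=> [e|/(glob_G2 hB) ->]; last by rewrite actM mulgVK.
have e' : act (iota a) (s * t^-1) = iota b.
  (* A global act need not be unital; that [1] fixes [iota b] comes from (Um) and (G2). *)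
  by rewrite -actM e actM mulgV -(glob_G2 hB (pact_Um hdot b)).
(* (G1) turns [e'] into definedness; (G2) and injectivity then identify the value. *)
have : isSome (dot a (s * t^-1)) by apply/(glob_G1 hB); exists b.
case d : dot => [c|//] _; congr Some; apply: (glob_inj hB).
by rewrite (glob_G2 hB d).
Qed.

Lemma tensor_pure_eq a s b t :
  tensor_pure dot a s = tensor_pure dot b t <-> dot a (s * t^-1) = Some b.
Proof.
split=> [/tensor_pureP h|d]; last first.
  by apply/tensor_pureP => R _; apply; exists (s * t^-1); rewrite /= mulgVK.
(* By minimality of [tensor_rho], it suffices that this relation is an equivalence containing
   [tensor_step]: (Um) gives reflexivity, (PA) transitivity, (I) symmetry. *)
apply: (h (fun x y => dot x.1 (x.2 * y.2^-1) = Some y.1)).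
- split=> [x|x y z xy yz|x y]; last exact: pact_divg_sym.
  + by rewrite mulgV (pact_Um hdot).
  + by rewrite -(mulgVK y.2 x.2) -mulgA; apply: pact_PA hdot _ _ _ _ _ xy yz.
- by move=> [a' s'] [b' t'] [u [/= -> d]]; rewrite mulgK.
Qed.

(** Forwards, evaluate both partial maps at [t^-1], where the second takes the value [b] by (Um).
    Backwards, (PA) shows that the first extends the second, and the symmetric form of the condition
    gives the reverse extension. *)
Lemma pfun_elt_eq a s b t :
  pfun_elt dot a s = pfun_elt dot b t <-> dot a (s * t^-1) = Some b.
Proof.
have sub a' s' b' t' u c : dot a' (s' * t'^-1) = Some b' ->
    dot b' (t' * u) = Some c -> dot a' (s' * u) = Some c.
  by move=> d /(pact_PA hdot d); rewrite mulgA mulgVK.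
split=> [/(congr1 (fun f => sval f t^-1))|d].
  by rewrite /= /pfun mulgV (pact_Um hdot).
apply: eq_exist; apply: funext => u; rewrite /pfun.
case e : (dot b (t * u)) => [c|]; first exact: sub d e.
case e' : (dot a (s * u)) => [c|//].
(* A value of the first map where the second is undefined would carry over to the second,
   contradicting [e]. *)
by rewrite (sub _ _ _ _ _ _ (pact_divg_sym d) e') in e.
Qed.

End PartialGroupAction.

Lemma tensor_pure_surj (S : semigroupType) (A : Type)
    (dot : A -> S -> option A) (x : tensor dot) :
  exists a s, x = tensor_pure dot a s.
Proof.
case E : (repr (x : {eq_quot tensor_equiv_rel dot})%qT) => [a s].
by exists a, s; rewrite /tensor_pure -E reprK.
Qed.

Lemma pfun_elt_surj (S : semigroupType) (A : Type)
    (dot : A -> S -> option A) (f : pfun_act dot) :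
  exists a s, f = pfun_elt dot a s.
Proof. by case: f => f [a [s e]]; exists a, s; apply: eq_exist. Qed.

Theorem corollary5p4 (S : groupType) (A : Type) (dot : A -> S -> option A)
    (hdot : is_partial_group_action dot) :
  (forall (B C : globalAct S) (iota : A -> B) (i : A -> C),
      is_globalization dot iota -> is_generated iota ->
      is_globalization dot i -> is_generated i ->
      exists phi : B -> C,
        unique (fun psi : B -> C =>
                  forall (a : A) (s : S),
                    psi (act (iota a) s) = act (i a) s) phi
        /\ is_act_iso phi)
  /\
  (exists phi : tensor dot -> pfun_act dot,
      unique (fun psi : tensor dot -> pfun_act dot =>
                forall (a : A) (s : S),
                  psi (tensor_pure dot a s) = pfun_elt dot a s) phi
      /\ is_act_iso phi).
Proof.
split=> [B C iota i hB gB hC gC|].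
- apply: (@unique_act_iso S A B C (fun a => act (iota a)) (fun a => act (i a)))
    => // [a s t|a s t|a s b t]; try exact: actM.
  by rewrite (glob_act_eq hdot hB) (glob_act_eq hdot hC).
- apply: unique_act_iso.
  + exact: tensor_pure_surj.
  + exact: pfun_elt_surj.
  + exact: tensor_act_opE.
  + exact: pfun_act_opE.
  + by move=> a s b t; rewrite (tensor_pure_eq hdot) (pfun_elt_eq hdot).
Qed.
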